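(* Let $X$ be a real random variable with distribution function $F$ and tail quantile function $U$. Assume that $U\in\mathrm{RV}_{\gamma}$ with $0<\gamma<1/2$. Then, as $\tau\uparrow 1$, $$dev_{\tau}(X)\sim\beta_{\gamma}\,q_{\tau},\qquad \beta_{\gamma}=\frac{(\gamma^{-1}-1)^{-\gamma}}{\sqrt{1-2\gamma}}.$$
   Context: For $\tau\in(0,1)$, $q_\tau=q_\tau(X)=\inf\{x\in\mathbb{R}:F(x)\ge\tau\}$ is the quantile. Write $x_+=\max\{x,0\}$, $x_-=-\min\{x,0\}$. The expectile of $X$ at level $\tau$ is $e_\tau=e_\tau(X)=\arg\min_{x\in\mathbb{R}}E[\tau(X-x)_+^2+(1-\tau)(X-x)_-^2]$. The adjusted standard-deviatile (deviatile) is $$dev_\tau(X)=\Big(\tfrac{\tau}{1-\tau}E[(X-e_\tau)_+^2]+E[(X-e_\tau)_-^2]\Big)^{1/2}.$$ The tail quantile function is $U(t)=F^{\leftarrow}(1-1/t)$, where $F^{\leftarrow}$ is the left-continuous inverse of $F$, so $q_\tau=U(1/(1-\tau))$. A measurable, eventually positive function $f$ is in $\mathrm{RV}_\gamma$ (regularly varying at $\infty$ with index $\gamma$) if $\lim_{t\to\infty}f(tx)/f(t)=x^\gamma$ for all $x>0$. $f(\tau)\sim g(\tau)$ means $f(\tau)/g(\tau)\to1$.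
   Formalization: The formal theorem additionally assumes that X_- has finite second moment, E[X_-^2] < ∞; without it the objective defining e_τ is identically +∞, so the argmin is not determined, and dev_τ(X) = +∞, so the claim fails. *)

(* Defs.v *)
From HB Require Import structures.
From mathcomp Require Import all_boot all_order all_algebra.
From mathcomp Require Import all_classical all_reals all_analysis.

Set Implicit Arguments.
Unset Strict Implicit.
Unset Printing Implicit Defensive.

Import Order.TTheory GRing.Theory Num.Theory.
Import numFieldNormedType.Exports.

Local Open Scope classical_set_scope.
Local Open Scope ring_scope.

Section Asymptotics.
Context {R : realType}.

(* A function meant on a half-line ]a, +oo[ only is to be extended to R in some
   measurable way; the extension is irrelevant for the other two clauses. *)
Definition regularly_varying (gamma : R) (f : R -> R) : Prop :=
  [/\ measurable_fun setT f,
      \forall t \near +oo, 0 < f t &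
      forall x, 0 < x -> f (t * x) / f t @[t --> +oo] --> x `^ gamma].

Definition asymp_equiv (F : set_system R) (f g : R -> R) : Prop :=
  f t / g t @[t --> F] --> (1 : R).

Definition pos_part (x : R) : R := Num.max x 0.
Definition neg_part (x : R) : R := - Num.min x 0.

End Asymptotics.

Section Deviatile.
Context d (T : measurableType d) (R : realType).
Context (P : probability T R) (X : {RV P >-> R}).

(* Meaningful for 0 < tau < 1; outside, the set may be empty or unbounded
   below, and then its inf is 0. *)
Definition quantile (tau : R) : R :=
  inf [set x | (tau%:E <= cdf X x)%E].

(* Meaningful for t > 1; elsewhere it is piecewise constant, so that
   measurability on R amounts to measurability on ]1, +oo[. *)
Definition tail_quantile (t : R) : R := quantile (1 - t^-1).

Definition expectile_loss (tau x : R) : \bar R :=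
  'E_P[fun w => (tau * pos_part (X w - x) ^+ 2
                 + (1 - tau) * neg_part (X w - x) ^+ 2)%R].

(* The minimizer is picked by choice; it exists and is unique for 0 < tau < 1
   when X has a finite second moment. *)
Definition expectile (tau : R) : R :=
  get [set x | forall y, (expectile_loss tau x <= expectile_loss tau y)%E].

(* Kept in \bar R, where it is +oo when X has no finite second moment. *)
Definition deviatile_sqr (tau : R) : \bar R :=
  ((tau / (1 - tau))%:E *
     'E_P[fun w => (pos_part (X w - expectile tau) ^+ 2)%R]
   + 'E_P[fun w => (neg_part (X w - expectile tau) ^+ 2)%R])%E.

(* Meaningful when X has a finite second moment: the argument of fine is then
   finite. *)
Definition deviatile (tau : R) : R := Num.sqrt (fine (deviatile_sqr tau)).

End Deviatile.

(* Main.v *)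
(* With alpha = 1/gamma, inverting U shows that the survival function N is
   regularly varying of index -alpha, and U(m/N(x)) ~ m^gamma x. Karamata's
   theorem (dominated convergence with a Potter bound, applied to layer-cake
   integrals) then gives
     E(X-x)_+ ~ x N(x) / (alpha-1),
     E(X-x)_+^2 ~ 2 x^2 N(x) / ((alpha-1)(alpha-2)).
   The expectile e is the root of the first-order condition
     (2 tau - 1) E(X-e)_+ = (1 - tau) (e - EX),
   so e -> +oo and 1 - tau ~ N(e)/(alpha-1). Hence q_tau ~ (alpha-1)^gamma e and
     dev_tau^2 / e^2 -> 2/(alpha-2) + 1 = 1/(1-2 gamma). *)
Require Import Defs.
From HB Require Import structures.
From mathcomp Require Import all_boot all_order all_algebra.
From mathcomp Require Import all_classical all_reals all_analysis.
From mathcomp Require Import measurable_realfun ring lra.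
Import Order.TTheory GRing.Theory Num.Theory.
Import numFieldNormedType.Exports.
Local Open Scope classical_set_scope.
Local Open Scope ring_scope.

Set Implicit Arguments.
Unset Strict Implicit.

(** The tail quantile function sees only the right tail: regular variation yields square
    integrability of the positive part of X, while that of the negative part enters as the
    hypothesis [hX]. The main obstacle is that U and N are mere generalized inverses, possibly with
    jumps and flat pieces, so U(1/N(x)) need not equal x. Passage between them therefore goes
    through the equivalence of U(t) <= x and N(x) <= 1/t for t > 1, followed by a squeeze between
    constants. Monotonicity of N and U likewise stands in for uniform convergence theorems, both in
    the Potter bound and when the factor m varies with tau. *)

(** * Limits and explicit integrals of powers *)

Lemma powRN_cvg_pinfty (R : realType) (a : R) : 0 < a ->
  x `^ (- a) @[x --> +oo] --> (0 : R).
Proof.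
move=> a0; apply/cvgrPdist_lt => e e0; near=> x.
have x0 : 0 < x by near: x; apply: nbhs_pinfty_gt; exact: num_real.
rewrite sub0r normrN ger0_norm ?powR_ge0//.
(* The threshold e^(-1/a) is the point where the power equals e. *)
have : (e `^ (- a^-1)) `^ (- a) > x `^ (- a).
  rewrite !(powRN _ a) ltf_pV2 ?posrE ?powR_gt0//.
  apply: gt0_ltr_powR; rewrite ?nnegrE ?powR_ge0 ?(ltW x0)//.
by rewrite -powRrM mulrNN mulVf ?gt_eqF// powRr1// ltW.
Unshelve. all: by end_near. Qed.

Lemma powR_continuous_gt0 (R : realType) (a x : R) : 0 < x ->
  {for x, continuous (fun y : R => y `^ a)}.
Proof.
move=> x0; apply: differentiable_continuous; apply/derivable1_diffP.
by apply: derivable_powR; rewrite in_itv/= x0.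
Qed.

Lemma integral_powR_1D (R : realType) (p : R) : 1 < p ->
  (\int[lebesgue_measure]_(u in `[0%R, +oo[) ((1 + u) `^ (- p))%:E
    = ((p - 1)^-1)%:E)%E.
Proof.
move=> p1.
have c (x a : R) : 0 <= x -> {for x, continuous (fun y : R => (1 + y) `^ a)}.
  move=> x0; apply: (@continuous_comp _ _ _ (fun y : R => 1 + y)
    (fun y : R => y `^ a)).
    by apply: continuousD; [exact: cvg_cst|exact: cvg_id].
  by apply: powR_continuous_gt0; lra.
pose F (x : R) := - (p - 1)^-1 * (1 + x) `^ (- (p - 1)).
have dF (x : R) : 0 < x -> is_derive x 1 F ((1 + x) `^ (- p)).
  move=> x0; rewrite /F.
  have h : is_derive x 1 (fun y : R => (1 + y) `^ (- (p - 1)))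
    ((- (p - 1) * (1 + x) `^ (- (p - 1) - 1)) * 1).
    apply: (@is_derive1_comp _ (fun y : R => y `^ (- (p - 1)))
      (fun y : R => 1 + y)).
      by apply: is_derive1_powR; lra.
    rewrite -[X in is_derive _ _ _ X]add0r.
    by apply: is_deriveD.
  have := is_deriveZ (- (p - 1)^-1) h.
  move=> /is_derive_eq; apply.
  rewrite mulr1 /GRing.scale/= mulrA mulrNN mulVf ?mul1r; last by lra.
  by congr (_ `^ _); lra.
rewrite (@ge0_continuous_FTC2y _ _ F 0 0).
- by rewrite /F addr0 powR1 mulr1 -EFinB; congr EFin; lra.
- by move=> x _; exact: powR_ge0.
- apply/continuous_within_itvcyP; split=> [x|].
    by rewrite in_itv/= andbT => /ltW; exact: c.
  by apply: cvg_at_right_filter; exact: c.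
- rewrite [X in _ --> X](_ : _ = - (p - 1)^-1 * 0); last by rewrite mulr0.
  apply: cvgMl_tmp.
  apply: (@cvg_comp _ _ _ (fun x : R => 1 + x)
    (fun y : R => y `^ (- (p - 1))) _ +oo).
    exact: cvg_addrl.
  by apply: powRN_cvg_pinfty; lra.
- by move=> x x0; apply: ex_derive; exact: dF.
- by apply: cvg_at_right_filter; apply: cvgMl_tmp; exact: c.
- move=> x; rewrite in_itv/= andbT => x0.
  by rewrite derive1E; have [_ ->] := dF _ x0.
Qed.

Lemma integral_powR_1Dsqrt (R : realType) (p : R) : 2 < p ->
  (\int[lebesgue_measure]_(u in `[0%R, +oo[) ((1 + Num.sqrt u) `^ (- p))%:E
    = (2 / ((p - 1) * (p - 2)))%:E)%E.
Proof.
move=> p2.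
have c (x a : R) : 0 <= x ->
    {for x, continuous (fun y : R => (1 + Num.sqrt y) `^ a)}.
  move=> x0; apply: (@continuous_comp _ _ _ (fun y : R => 1 + Num.sqrt y)
    (fun y : R => y `^ a)).
    by apply: continuousD; [exact: cvg_cst|exact: sqrt_continuous].
  by apply: powR_continuous_gt0; have := sqrtr_ge0 x; lra.
(* Substituting x = s^2 gives the integrand 2s(1+s)^-p = 2(1+s)^(1-p) - 2(1+s)^-p, whose
   antiderivative in s is read off termwise. *)
pose F (x : R) := (2 / (p - 1)) * (1 + Num.sqrt x) `^ (- (p - 1))
  + (- (2 / (p - 2))) * (1 + Num.sqrt x) `^ (- (p - 2)).
(* The square root is not differentiable at 0; there the fundamental theorem asks only for right
   continuity. *)
have d (x a : R) : 0 < x -> is_derive x 1 (fun y : R => (1 + Num.sqrt y) `^ a)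
    ((a * (1 + Num.sqrt x) `^ (a - 1)) * (2 * Num.sqrt x)^-1).
  move=> x0.
  apply: (@is_derive1_comp _ (fun y : R => y `^ a)
    (fun y : R => 1 + Num.sqrt y)).
    by apply: is_derive1_powR; have := sqrtr_ge0 x; lra.
  rewrite -[X in is_derive _ _ _ X]add0r.
  by apply: is_deriveD; exact: is_derive1_sqrt.
have dF (x : R) : 0 < x -> is_derive x 1 F ((1 + Num.sqrt x) `^ (- p)).
  move=> x0; rewrite /F.
  have h1 := is_deriveZ (2 / (p - 1)) (d x (- (p - 1)) x0).
  have h2 := is_deriveZ (- (2 / (p - 2))) (d x (- (p - 2)) x0).
  have := is_deriveD h1 h2.
  move=> /is_derive_eq; apply; rewrite /GRing.scale/=.
  have s0 : 0 < Num.sqrt x by rewrite sqrtr_gt0.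
  have -> : - (p - 1) - 1 = - p by lra.
  have -> : - (p - 2) - 1 = - p + 1 by lra.
  rewrite (@powRD _ _ (- p) 1); last first.
    by apply/implyP => _; rewrite gt_eqF//; lra.
  rewrite powRr1; last by lra.
  by field; rewrite !gt_eqF//; lra.
rewrite (@ge0_continuous_FTC2y _ _ F 0 0).
- rewrite /F sqrtr0 addr0 !powR1 !mulr1 -EFinB; congr EFin.
  by field; rewrite !gt_eqF//; lra.
- by move=> x _; exact: powR_ge0.
- apply/continuous_within_itvcyP; split=> [x|].
    by rewrite in_itv/= andbT => /ltW; exact: c.
  by apply: cvg_at_right_filter; exact: c.
- rewrite [X in _ --> X](_ : _ = (2 / (p - 1)) * 0 + - (2 / (p - 2)) * 0);
    last by rewrite !mulr0 addr0.
  have h (a : R) : 0 < a -> (1 + Num.sqrt x) `^ (- a) @[x --> +oo] --> (0:R).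
    move=> a0.
    apply: (@cvg_comp _ _ _ (fun x : R => 1 + Num.sqrt x)
        (fun y : R => y `^ (- a)) _ +oo).
      apply: (@cvg_comp _ _ _ (@Num.sqrt R) (fun x : R => 1 + x) _ +oo);
        last exact: cvg_addrl.
      apply/cvgryPgt => A; near=> x.
      have x0 : 0 <= x by near: x; apply: nbhs_pinfty_ge; exact: num_real.
      have [A0|A0] := ltP A 0; first by rewrite (lt_le_trans A0)// sqrtr_ge0.
      rewrite -[A]ger0_norm// -sqrtr_sqr ltr_sqrt//.
      by near: x; apply: nbhs_pinfty_gt; exact: num_real.
    exact: powRN_cvg_pinfty.
  by apply: cvgD; apply: cvgMl_tmp; apply: h; lra.
- by move=> x x0; apply: ex_derive; exact: dF.
- by apply: cvg_at_right_filter; apply: cvgD; apply: cvgMl_tmp; exact: c.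
- move=> x; rewrite in_itv/= andbT => x0.
  by rewrite derive1E; have [_ ->] := dF _ x0.
Unshelve. all: by end_near. Qed.

(** * Potter bound and Karamata's theorem *)

(** Each halving of y spends one factor 2^-p, until y <= 2; there monotonicity suffices, because the
    constant 2^p makes 2^p y^-p at least 1. *)
Lemma decay_bound_of_doubling (R : realType) (N : R -> R) (p x0 : R) :
  0 < p -> 0 < x0 -> {homo N : x y /~ x <= y} -> (forall x, 0 < N x) ->
  (forall x, x0 <= x -> N (x * 2) <= 2 `^ (- p) * N x) ->
  forall x y, x0 <= x -> 1 <= y -> N (x * y) <= 2 `^ p * y `^ (- p) * N x.
Proof.
move=> p0 x00 Nni Npos dbl.
suff H n : forall x y, x0 <= x -> 1 <= y <= 2 ^+ n ->
    N (x * y) <= 2 `^ p * y `^ (- p) * N x.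
  move=> x y xx0 y1; apply: (H (Num.bound y)) => //; rewrite y1/=.
  have /ltW/le_trans : y < (Num.bound y)%:R.
    by apply: archi_boundP; lra.
  apply; rewrite -natrX ler_nat; exact/ltnW/ltn_expl.
elim: n => [|n ih] x y xx0 /andP[y1 yn].
  have -> : y = 1 by apply/eqP; rewrite eq_le y1 -(expr0 2) yn.
  rewrite mulr1 powR1 mulr1 ler_peMl ?(ltW (Npos _))//.
  have : (1 : R) `^ p <= 2 `^ p.
    by apply: ge0_ler_powR; rewrite ?nnegrE ?ler1n// ltW.
  by rewrite powR1.
have [y2|y2] := leP y 2.
  apply: (@le_trans _ _ (N x)); first by apply: Nni; rewrite ler_peMr//; lra.
  rewrite ler_peMl ?(ltW (Npos _))// powRN ler_pdivlMr ?powR_gt0//; last by lra.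
  by rewrite mul1r; apply: ge0_ler_powR; rewrite ?nnegrE//; lra.
have -> : x * y = x * 2 * (y / 2) by field.
have y20 : 0 < y / 2 by lra.
apply: (le_trans (ih _ _ _ _)).
- by apply: (le_trans xx0); rewrite ler_peMr//; lra.
- move: yn; rewrite exprSr => yn; apply/andP; split; first by lra.
  by rewrite ler_pdivrMr.
- apply: le_trans (ler_wpM2l _ (dbl x xx0)) _.
    by rewrite mulr_ge0 ?powR_ge0.
  have e : y `^ (- p) = (y / 2) `^ (- p) * 2 `^ (- p).
    by rewrite -powRM ?divfK//; lra.
  by rewrite e !mulrA.
Qed.

(** The gap p < a gives 2^-a < 2^-p, so the limit at the single ratio 2 eventually yields the
    doubling inequality, and monotonicity extends it to all y >= 1. *)
Lemma potter_bound (R : realType) (N : R -> R) (p a : R) :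
  0 < p < a -> {homo N : x y /~ x <= y} -> (forall x, 0 < N x) ->
  N (x * 2) / N x @[x --> +oo] --> 2 `^ (- a) ->
  exists2 x0, 0 < x0 & forall x y, x0 <= x -> 1 <= y ->
    N (x * y) <= 2 `^ p * y `^ (- p) * N x.
Proof.
move=> /andP[p0 pa] Nni Npos N2.
have ap : 2 `^ (- a) < (2 : R) `^ (- p).
  by rewrite /powR pnatr_eq0/= ltr_expR ltr_pM2r ?ln_gt0 ?ltr1n//; lra.
have [x0 [_ hx0]] := @cvgr_lt _ _ _ _ _ _ N2 _ ap.
exists (Num.max x0 0 + 1); first by rewrite ltr_wpDl// le_max lexx orbT.
apply: decay_bound_of_doubling => //.
  by rewrite ltr_wpDl// le_max lexx orbT.
move=> x xx0; rewrite -ler_pdivrMr//; apply/ltW/hx0.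
apply: lt_le_trans xx0; rewrite ltr_pwDr// le_max lexx//.
Qed.

(* psi u = 1 + u and psi u = 1 + sqrt u are the layer-cake integrands of the
   first and second moments of the relative excess (X/x - 1)_+. *)
Section Karamata.
Context {R : realType}.
Local Notation mu := (@lebesgue_measure R).
Local Notation D := (`[0%R, +oo[%classic : set R).
Variables (N psi : R -> R) (a p : R).
Hypothesis p_bnd : 0 < p < a.
Hypothesis N_ni : {homo N : x y /~ x <= y}.
Hypothesis N_gt0 : forall x, 0 < N x.
Hypothesis N_rv : forall l, 0 < l ->
  N (x * l) / N x @[x --> +oo] --> l `^ (- a).
Hypothesis mpsi : measurable_fun setT psi.
Hypothesis psi_ge1 : forall u, 0 <= u -> 1 <= psi u.
Hypothesis psi_int : (\int[mu]_(u in D) (psi u `^ (- p))%:E < +oo)%E.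

Let mN : measurable_fun setT N.
Proof.
by apply: nonincreasing_measurable => // x y; exact: N_ni.
Qed.

Let mNpsi x : measurable_fun D (fun u => N (x * psi u)).
Proof.
apply: measurable_funTS; apply: measurableT_comp => //.
exact: measurable_funM.
Qed.

Let dominating : mu.-integrable D (fun u => (2 `^ p * psi u `^ (- p))%:E).
Proof.
apply: (@integrableZl _ _ _ mu D _ (2 `^ p)
  (fun u => (psi u `^ (- p))%:E)) => //.
apply/integrableP; split.
  apply/measurable_EFinP; apply: measurable_funTS.
  exact: (measurableT_comp (measurable_powR _)).
by under eq_integral do rewrite gee0_abs ?lee_fin ?powR_ge0//.
Qed.

Lemma karamata_integrable : exists2 x0, 0 < x0 & forall x, x0 <= x ->
  mu.-integrable D (fun u => (N (x * psi u))%:E).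
Proof.
have [x0 x00 P] := potter_bound p_bnd N_ni N_gt0 (N_rv (ltr0Sn R 1)).
exists x0 => // x xx0.
apply: (@le_integrable _ _ _ mu D _ _
  (fun u => (N x)%:E * (2 `^ p * psi u `^ (- p))%:E)%E) => //.
- by apply/measurable_EFinP; exact: mNpsi.
- move=> u; rewrite /= in_itv/= andbT => u0.
  rewrite /= lee_fin !ger0_norm ?(ltW (N_gt0 _))//.
    by rewrite [leRHS]mulrC P// psi_ge1.
  by rewrite !mulr_ge0 ?powR_ge0// ltW.
- by apply: integrableZl; [by []|exact: dominating].
Qed.

Lemma karamata_cvg :
  (\int[mu]_(u in D) N (x * psi u)) / N x @[x --> +oo] -->
  \int[mu]_(u in D) (psi u `^ (- a)).
Proof.
have [x0 x00 P] := potter_bound p_bnd N_ni N_gt0 (N_rv (ltr0Sn R 1)).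
have [x1 x10 I] := karamata_integrable.
pose x2 := Num.max x0 x1.
apply/cvg_pinftyP => v voo.
(* [v] passes the thresholds only eventually; raising it to [x2] makes the Potter domination hold
   for every n without changing the tail of the sequence. *)
pose w n := Num.max (v n) x2.
have woo : w n @[n --> \oo] --> +oo.
  apply/cvgryPge => A; move/cvgryPge : voo => /(_ A).
  by apply: filterS => n An; rewrite le_max An.
have w0 n : x0 <= w n by rewrite !le_max lexx orbT.
have w1 n : x1 <= w n by rewrite !le_max lexx !orbT.
apply: (@cvg_trans _ ((\int[mu]_(u in D) (N (w n * psi u) / N (w n)))
    @[n --> \oo])).
  apply: near_eq_cvg; move/cvgryPge : voo => /(_ x2).
  apply: filterS => n x2n.
  have -> : w n = v n by apply/max_idPl.
  rewrite RintegralZr//; apply: I.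
  by apply: le_trans x2n; rewrite le_max lexx orbT.
have [] := @dominated_convergence _ _ _ mu D _
  (fun n u => (N (w n * psi u) / N (w n))%:E) (fun u => (psi u `^ (- a))%:E)
  (fun u => (2 `^ p * psi u `^ (- p))%:E).
- by [].
- move=> n; apply/measurable_EFinP; apply: measurable_funM => //.
  exact: mNpsi.
- apply/measurable_EFinP; apply: measurable_funTS.
  exact: (measurableT_comp (measurable_powR _)).
- apply: aeW => u; rewrite /= in_itv/= andbT => u0.
  apply: cvg_EFin; first exact: nearW.
  have psi0 : 0 < psi u by apply: (lt_le_trans ltr01); exact: psi_ge1.
  exact: (cvg_pinftyP _ _).1 (N_rv psi0) _ woo.
- exact: dominating.
- apply: aeW => u n; rewrite /= in_itv/= andbT => u0.
  rewrite /= lee_fin ger0_norm; last by rewrite divr_ge0// ltW.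
  by rewrite ler_pdivrMr// P// psi_ge1.
move=> lim_int _ cv; rewrite /Rintegral; apply: fine_cvg => /=.
by rewrite fineK//; apply: integrable_fin_num.
Qed.

End Karamata.

(** * The survival function and the inversion of U *)

Section Tail.
Context d (T : measurableType d) (R : realType) (P : probability T R).
Variable X : {RV P >-> R}.

Definition survival (x : R) : R := fine (ccdf X x).

Lemma EFin_survival x : (survival x)%:E = ccdf X x.
Proof. by rewrite /survival fineK// fin_num_measure. Qed.

Lemma survival_ge0 x : 0 <= survival x.
Proof. by rewrite fine_ge0// measure_ge0. Qed.

Lemma survival_nonincreasing : {homo survival : x y /~ x <= y}.
Proof.
by move=> x y xy; rewrite -lee_fin !EFin_survival; exact: ccdf_nonincreasing.
Qed.

Lemma survival_cvg0 : survival x @[x --> +oo] --> (0 : R).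
Proof. by apply: fine_cvg; exact: cvg_ccdfy0. Qed.

Lemma cdf_survival x : cdf X x = (1 - survival x)%:E.
Proof. by rewrite cdf_1_ccdf EFinB EFin_survival. Qed.

Lemma survival_right_continuous x : survival y @[y --> x^'+] --> survival x.
Proof.
apply: fine_cvg; rewrite EFin_survival; exact: ccdf_right_continuous.
Qed.

(** The set under the infimum is upward closed and, by right continuity of the distribution
    function, contains its infimum. *)
Lemma quantile_le (tau x : R) : 0 < tau < 1 ->
  (quantile X tau <= x) = (tau <= 1 - survival x).
Proof.
move=> /andP[tau0 tau1].
pose S := [set y | (tau%:E <= cdf X y)%E].
have SE y : S y = (tau <= 1 - survival y) :> Prop.
  by rewrite /S/= cdf_survival lee_fin.
(* The limits of the survival function at both ends give a point and a lower bound, which excludes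
   the default value of [inf]. *)
have S0 : S !=set0.
  have [M [_ hM]] := @cvgr_lt _ _ _ _ _ _ survival_cvg0 (1 - tau) ltac:(lra).
  exists (M + 1); rewrite SE; have := hM (M + 1) ltac:(lra); lra.
have lbS : has_lbound S.
  have cN : survival x @[x --> -oo] --> (1 : R).
    by apply: fine_cvg; exact: cvg_ccdfNy1.
  have [M [_ hM]] := @cvgr_gt _ _ _ _ _ _ cN (1 - tau) ltac:(lra).
  exists M => y; rewrite SE => Sy; rewrite leNgt; apply/negP => yM.
  by have := hM y yM; lra.
apply/idP/idP => [qx|Sx]; last first.
  by apply: ge_inf => //; rewrite -/S SE.
have gtx y : x < y -> survival y <= 1 - tau.
  move=> xy; have : inf S < y by exact: le_lt_trans xy.
  move=> /(inf_lt S0)[z]; rewrite SE => Sz zy.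
  have := survival_nonincreasing (ltW zy); lra.
have : survival x <= 1 - tau; last by lra.
apply: (@cvgr_to_le _ _ _ _ _ _ _ (@survival_right_continuous x)).
near=> y; apply: gtx; near: y; exact: nbhs_right_gt.
Unshelve. all: by end_near. Qed.

Lemma tail_quantile_le (t x : R) : 1 < t ->
  (tail_quantile X t <= x) = (survival x <= t^-1).
Proof.
move=> t1; rewrite quantile_le; first by apply/idP/idP; lra.
have : t^-1 < 1 by rewrite invf_lt1//; lra.
have : 0 < t^-1 by rewrite invr_gt0; lra.
by move=> ? ?; lra.
Qed.

Lemma tail_quantile_nondecreasing (s t : R) : 1 < s -> s <= t ->
  tail_quantile X s <= tail_quantile X t.
Proof.
move=> s1 st; rewrite tail_quantile_le//.
apply: (@le_trans _ _ t^-1).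
  by rewrite -tail_quantile_le//; lra.
by rewrite lef_pV2// posrE; lra.
Qed.

Variable gamma : R.
Hypothesis gamma0 : 0 < gamma.
Hypothesis hU : regularly_varying gamma (tail_quantile X).

(** If N vanished at x, U would be bounded by x on t > 1; but U(2t)/U(t) tends to 2^gamma > 1, which
    rules out a finite positive supremum. *)
Lemma survival_gt0 x : 0 < survival x.
Proof.
rewrite lt_neqAle survival_ge0 andbT eq_sym; apply/negP => /eqP Nx.
have [_ Upos Urv] := hU.
pose S := [set tail_quantile X t | t in [set t | 1 < t]].
have ubS : ubound S x.
  move=> _ [t /= t1 <-]; rewrite tail_quantile_le// Nx invr_ge0; lra.
have S0 : S !=set0 by exists (tail_quantile X 2), 2 => //=; rewrite ltr1n.
have hS : has_sup S by split => //; exists x.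
have g1 : (1 : R) < 2 `^ gamma.
  rewrite -[ltLHS](powRr0 2) /powR pnatr_eq0/= ltr_expR.
  by rewrite ltr_pM2r ?ln_gt0 ?ltr1n.
(* With 1 < c < 2^gamma, a value of U above sup S / c is pushed beyond sup S by one doubling of a
   large argument. *)
pose c : R := (1 + 2 `^ gamma) / 2.
have c1 : 1 < c by rewrite /c; lra.
have cg : c < 2 `^ gamma by rewrite /c; lra.
have supS t : 1 < t -> tail_quantile X t <= sup S.
  by move=> t1; apply: sup_upper_bound => //; exists t.
have [t0 [_ ht0]] := Upos.
have [t1 [_ ht1]] := @cvgr_gt _ _ _ _ _ _ (Urv 2 (ltr0Sn R 1)) _ cg.
have s0 : 0 < sup S.
  pose t := Num.max t0 1 + 1.
  have : Num.max t0 1 < t by rewrite /t; lra.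
  rewrite gt_max => /andP[t0t tt1].
  exact: lt_le_trans (ht0 t t0t) (supS _ tt1).
have [_ [t2 /= t21 <-] ht2] : exists2 y, S y & sup S / c < y.
  apply: sup_gt => //; rewrite ltr_pdivrMr; last lra.
  by rewrite ltr_pMr.
pose t := Num.max (Num.max t0 t1) t2 + 1.
have : Num.max (Num.max t0 t1) t2 < t by rewrite /t; lra.
rewrite !gt_max -andbA => /and3P[t0t t1t t2t].
have U0 := ht0 _ t0t.
have := ht1 _ t1t; rewrite /= ltr_pdivlMr// => Ut.
have := supS (t * 2) ltac:(lra).
have := tail_quantile_nondecreasing t21 (ltW t2t).
move: ht2; rewrite ltr_pdivrMr; last lra.
move=> h1 h2 h3.
have : tail_quantile X t2 * c <= tail_quantile X t * c.
  by rewrite ler_pM2r//; lra.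
lra.
Qed.

Lemma inv_survival_cvgy : (survival x)^-1 @[x --> +oo] --> +oo.
Proof.
apply/cvgryPge => A; have [A0|A0] := leP A 0; near=> x.
  by rewrite (le_trans A0)// invr_ge0 survival_ge0.
rewrite -[A]invrK lef_pV2 ?posrE ?invr_gt0 ?survival_gt0//.
by near: x; apply: (cvgr_le _ survival_cvg0); rewrite invr_gt0.
Unshelve. all: by end_near. Qed.

(** Once N(x) < 1, U(1/N(x)) <= x, possibly strictly, yet x < U(k/N(x)) for every k > 1 because N(x)
    > N(x)/k. Regular variation makes the loss about k^gamma, and k can be taken as close to 1 as
    desired. *)
Lemma tail_quantile_inv_survival (m : R) : 0 < m ->
  tail_quantile X (m / survival x) / x @[x --> +oo] --> m `^ gamma.
Proof.
move=> m0.
have [_ Upos Urv] := hU.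
have Uc (l : R) : 0 < l -> tail_quantile X (l / survival x) /
    tail_quantile X (survival x)^-1 @[x --> +oo] --> l `^ gamma.
  move=> l0; under eq_fun do rewrite [l / _]mulrC.
  exact: (cvg_comp _ _ inv_survival_cvgy (Urv l l0)).
have Up : \forall x \near +oo, 0 < tail_quantile X (survival x)^-1.
  exact: (inv_survival_cvgy Upos).
have N1 : \forall x \near +oo, survival x < 1.
  by apply: (cvgr_lt _ survival_cvg0).
have U1 : tail_quantile X (survival x)^-1 / x @[x --> +oo] --> (1 : R).
  apply/cvgrPdist_le => e e0.
  (* The constants satisfy 1 - e <= b < c < 1, the entries 1/2 and 1/4 keeping them positive for
     large e; k is then chosen so that k^gamma = 1/c, strictly below 1/b. *)
  pose c := Num.max (2^-1) (1 - e / 2).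
  have c0 : 0 < c by rewrite lt_max invr_gt0 ltr0n.
  pose b := Num.max (4^-1) (1 - e).
  have b0 : 0 < b by rewrite lt_max invr_gt0 ltr0n.
  have bc : b < c.
    by rewrite gt_max !lt_max; apply/andP; split; apply/orP; [left|right]; lra.
  have c1 : c < 1 by rewrite gt_max; apply/andP; split; lra.
  pose k := c `^ (- gamma^-1).
  have k1 : 1 < k.
    rewrite /k /powR gt_eqF// -[ltLHS]expR0 ltr_expR nmulr_rgt0.
      by rewrite ln_lt0// c0.
    by rewrite oppr_lt0 invr_gt0.
  have kg : k `^ gamma = c^-1.
    by rewrite /k -powRrM mulNr mulVf ?gt_eqF// powR_inv1// ltW.
  have kb : k `^ gamma < b^-1 by rewrite kg ltf_pV2.
  near=> x.
  have x0 : 0 < x by [].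
  have Nx := survival_gt0 x.
  have Nx1 : survival x < 1 by near: x.
  have Ux0 : 0 < tail_quantile X (survival x)^-1 by near: x.
  have Ux : tail_quantile X (survival x)^-1 <= x.
    by rewrite tail_quantile_le ?invrK// invf_gt1.
  rewrite ger0_norm; last by rewrite subr_ge0 ler_pdivrMr ?mul1r.
  suff : b <= tail_quantile X (survival x)^-1 / x.
    have : 1 - e <= b by rewrite le_max lexx orbT.
    lra.
  have xU : x < tail_quantile X (k / survival x).
    rewrite ltNge tail_quantile_le; last by rewrite ltr_pdivlMr// mul1r; lra.
    by rewrite invf_div -ltNge ltr_pdivrMr ?ltr_pMr//; lra.
  have : tail_quantile X (k / survival x) / tail_quantile X (survival x)^-1
    < b^-1 by near: x; apply: (cvgr_lt _ (Uc k _)) => //; lra.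
  rewrite ltr_pdivrMr// => h.
  rewrite ler_pdivlMr// -ler_pdivlMl//.
  by apply/ltW; apply: (lt_trans xU).
rewrite -[X in _ --> X]mulr1.
apply: cvg_trans (cvgM (Uc m m0) U1).
apply: near_eq_cvg; near=> x => /=.
have Ux0 : 0 < tail_quantile X (survival x)^-1 by near: x.
by rewrite mulrA divfK// gt_eqF.
Unshelve. all: by end_near. Qed.

(** For t = 1/(b N(x)) > 1, the inequality U(t) <= l x says N(l x) <= b N(x). Since U(t)/x tends to
    b^-gamma, comparing b^-gamma with l, that is b with L, bounds the ratio from both sides. *)
Lemma survival_rv (l : R) : 0 < l ->
  survival (x * l) / survival x @[x --> +oo] --> l `^ (- gamma^-1).
Proof.
move=> l0.
pose L := l `^ (- gamma^-1).
have L0 : 0 < L by exact: powR_gt0.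
have LV : L^-1 `^ gamma = l.
  by rewrite /L powRN invrK -powRrM mulVf ?gt_eqF// powRr1// ltW.
have ltL (b : R) : L < b -> b^-1 `^ gamma < l.
  move=> Lb; have b0 : 0 < b by exact: lt_trans Lb.
  by rewrite -LV; apply: gt0_ltr_powR; rewrite ?nnegrE ?invr_ge0 ?ltW// ltf_pV2.
have gtL (b : R) : 0 < b -> b < L -> l < b^-1 `^ gamma.
  move=> b0 bL.
  by rewrite -LV; apply: gt0_ltr_powR; rewrite ?nnegrE ?invr_ge0 ?ltW// ltf_pV2.
have N1 (m : R) : 0 < m -> \forall x \near +oo, survival x < m.
  by move=> m0; apply: (cvgr_lt _ survival_cvg0).
apply/cvgrPdist_le => e e0; rewrite -/L.
have b10 : 0 < L + e by lra.
(* The entry L / 2 keeps b positive when e >= L. *)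
pose b := Num.max (L / 2) (L - e).
have b0 : 0 < b by rewrite lt_max divr_gt0.
have bL : b < L by rewrite gt_max; apply/andP; split; lra.
have be : L - e <= b by rewrite le_max lexx orbT.
near=> x.
have x0 : 0 < x by [].
have Nx := survival_gt0 x.
have up : survival (x * l) / survival x <= L + e.
  have : tail_quantile X ((L + e)^-1 / survival x) / x < l.
    near: x; apply: (cvgr_lt _ (tail_quantile_inv_survival _)).
      by rewrite invr_gt0.
    by apply: ltL; lra.
  rewrite ltr_pdivrMr// [l * x]mulrC => /ltW; rewrite tail_quantile_le.
    by rewrite invf_div invrK ler_pdivrMr// [_ * (L + e)]mulrC.
  by rewrite ltr_pdivlMr// mul1r; near: x; apply: N1; rewrite invr_gt0.
have dn : b <= survival (x * l) / survival x.
  have : l < tail_quantile X (b^-1 / survival x) / x.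
    near: x; apply: (cvgr_gt _ (tail_quantile_inv_survival _)).
      by rewrite invr_gt0.
    by exact: gtL.
  rewrite ltr_pdivlMr// [l * x]mulrC ltNge tail_quantile_le.
    rewrite -ltNge invf_div invrK => /ltW.
    by rewrite ler_pdivlMr// [b * _]mulrC.
  by rewrite ltr_pdivlMr// mul1r; near: x; apply: N1; rewrite invr_gt0.
by rewrite ler_norml; lra.
Unshelve. all: by end_near. Qed.

End Tail.

(** * Layer-cake formula and upper partial moments *)

Lemma measurable_pos_part (R : realType) : measurable_fun setT (@pos_part R).
Proof. exact: measurable_maxr. Qed.

Lemma measurable_neg_part (R : realType) : measurable_fun setT (@neg_part R).
Proof. by apply: measurableT_comp => //; exact: measurable_minr. Qed.

Section UpperPartialMoments.
Context d (T : measurableType d) (R : realType) (P : probability T R).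
Variable X : {RV P >-> R}.
Local Notation mu := (@lebesgue_measure R).
Local Notation D := (`[0%R, +oo[%classic : set R).

(** The map [g] turns superlevel sets of [f] into those of [X], so the layer-cake formula for [f]
    can be read with the survival function of [X]. *)
Lemma integral_survival (f : T -> R) (g : R -> R) :
  measurable_fun setT f -> (forall w, 0 <= f w) ->
  (forall u w, 0 <= u -> (u < f w) = (g u < X w)) ->
  (\int[P]_w (f w)%:E = \int[mu]_(u in D) (survival X (g u))%:E)%E.
Proof.
move=> mf f0 fX.
have := @ge0_expectation_ccdf _ _ _ P (mfun_Sub (mem_set mf)) f0.
rewrite expectation_def => ->.
apply: eq_integral => u; rewrite inE/= in_itv/= andbT => u0.
rewrite EFin_survival /ccdf /distribution /pushforward.
congr (P _); apply/seteqP; split => w /=;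
  by rewrite !in_itv/= !andbT fX.
Qed.

Variable gamma : R.
Hypothesis gamma0 : 0 < gamma.
Hypothesis hU : regularly_varying gamma (tail_quantile X).

Variables (k : nat) (psi : R -> R) (p : R).
Hypothesis psiE : forall u y, 0 <= u -> (u < pos_part y ^+ k) = (psi u - 1 < y).
Hypothesis p_bnd : 0 < p < gamma^-1.
Hypothesis mpsi : measurable_fun setT psi.
Hypothesis psi_ge1 : forall u, 0 <= u -> 1 <= psi u.
Hypothesis psi_int : (\int[mu]_(u in D) (psi u `^ (- p))%:E < +oo)%E.

(** For x > 0, dividing by x turns u < [scaled x w] into x psi(u) < X, the form Karamata's theorem
    expects; psi(u) - 1 plays the k-th root of u. *)
Let scaled x w := pos_part (X w / x - 1) ^+ k.

Let scaledE x w : 0 < x -> pos_part (X w - x) ^+ k = x ^+ k * scaled x w.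
Proof.
move=> x0; rewrite /scaled -exprMn; congr (_ ^+ _).
rewrite /pos_part maxr_pMr ?ltW// mulr0 mulrBr mulr1 mulrCA.
by rewrite divff ?gt_eqF// mulr1.
Qed.

Let mscaled x : measurable_fun setT (scaled x).
Proof.
apply: measurable_funX; apply: (measurableT_comp (@measurable_pos_part R)).
by apply: measurable_funB => //; exact: measurable_funM.
Qed.

Let integral_scaled x : 0 < x -> (\int[P]_w (scaled x w)%:E =
  \int[mu]_(u in D) (survival X (x * psi u))%:E)%E.
Proof.
move=> x0; apply: integral_survival => //.
  by move=> w; rewrite exprn_ge0// le_max lexx orbT.
by move=> u w u0; rewrite psiE// ltrBlDr subrK ltr_pdivlMr// mulrC.
Qed.

Let Nni : {homo survival X : x y /~ x <= y}.
Proof. exact: survival_nonincreasing. Qed.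

Let Npos x : 0 < survival X x. Proof. exact: survival_gt0 gamma0 hU x. Qed.

Let Nrv l : 0 < l ->
  survival X (x * l) / survival X x @[x --> +oo] --> l `^ (- gamma^-1).
Proof. exact: survival_rv. Qed.

Let scaled_integrable : exists2 x0, 0 < x0 & forall x, x0 <= x ->
  P.-integrable setT (EFin \o scaled x).
Proof.
have [x0 x00 I] :=
  karamata_integrable p_bnd Nni Npos Nrv mpsi psi_ge1 psi_int.
exists x0 => // x xx0; have x1 : 0 < x by exact: lt_le_trans xx0.
apply/integrableP; split; first exact/measurable_EFinP.
under eq_integral do
  rewrite gee0_abs ?lee_fin ?exprn_ge0// ?le_max ?lexx ?orbT//.
rewrite integral_scaled//.
have /integrableP[_] := I _ xx0.
by under eq_integral do rewrite gee0_abs ?lee_fin ?survival_ge0//.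
Qed.

Lemma upper_moment_integrable : exists2 x0, 0 < x0 & forall x, x0 <= x ->
  P.-integrable setT (fun w => (pos_part (X w - x) ^+ k)%:E).
Proof.
have [x0 x00 I] := scaled_integrable.
exists x0 => // x xx0; have x1 : 0 < x by exact: lt_le_trans xx0.
under eq_fun do rewrite scaledE// EFinM.
by apply: integrableZl => //; exact: I.
Qed.

Lemma upper_moment_cvg :
  (\int[P]_w (pos_part (X w - x) ^+ k)) / (x ^+ k * survival X x)
    @[x --> +oo] --> \int[mu]_(u in D) (psi u `^ (- gamma^-1)).
Proof.
have [x0 x00 I] := scaled_integrable.
have := karamata_cvg p_bnd Nni Npos Nrv mpsi psi_ge1 psi_int.
apply: cvg_trans; apply: near_eq_cvg; near=> x.
have xx0 : x0 <= x by near: x; apply: nbhs_pinfty_ge; exact: num_real.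
have x1 : 0 < x by exact: lt_le_trans xx0.
under [in RHS]eq_Rintegral do rewrite scaledE//.
rewrite RintegralZl//; last exact: I.
rewrite -mulf_div divff ?mul1r ?expf_neq0 ?gt_eqF//.
by rewrite /Rintegral -integral_scaled.
Unshelve. all: by end_near. Qed.

End UpperPartialMoments.

(** * Second moments from regular variation *)

Section SecondMoment.
Context d (T : measurableType d) (R : realType) (P : probability T R).
Variable X : {RV P >-> R}.

Definition upper_mean (x : R) : R := \int[P]_w pos_part (X w - x).
Definition upper_sqr (x : R) : R := \int[P]_w (pos_part (X w - x) ^+ 2).

Section RegularlyVarying.
Variable gamma : R.
Hypothesis hgamma : 0 < gamma < 2^-1.
Hypothesis hU : regularly_varying gamma (tail_quantile X).

Let gamma0 : 0 < gamma. Proof. by case/andP: hgamma. Qed.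

Let alpha2 : 2 < gamma^-1.
Proof.
by case/andP: hgamma => g0 g2; rewrite -[2]invrK ltf_pV2 ?posrE ?invr_gt0.
Qed.

Lemma upper_mean_cvg :
  upper_mean x / (x * survival X x) @[x --> +oo] --> (gamma^-1 - 1)^-1.
Proof.
have <- : \int[lebesgue_measure]_(u in `[0%R, +oo[) ((1 + u) `^ (- gamma^-1))
    = (gamma^-1 - 1)^-1.
  by rewrite /Rintegral integral_powR_1D//; move: alpha2; lra.
(* The exponent is the midpoint of 1, beyond which the power of 1 + u is integrable, and 1/gamma,
   below which the Potter bound applies. *)
apply: (@upper_moment_cvg _ _ _ _ X _ gamma0 hU 1 (fun u => 1 + u)
  ((1 + gamma^-1) / 2)).
- move=> u y u0; rewrite expr1 /pos_part lt_max [u < 0]ltNge u0 orbF.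
  by rewrite addrAC subrr add0r.
- by apply/andP; split; move: alpha2; lra.
- exact: measurable_funD.
- by move=> u u0; lra.
- by rewrite integral_powR_1D ?ltry//; move: alpha2; lra.
Qed.

Let sqrt_excess (u y : R) : 0 <= u ->
  (u < pos_part y ^+ 2) = (1 + Num.sqrt u - 1 < y).
Proof.
move=> u0; rewrite addrAC subrr add0r /pos_part.
have [y0|y0] := leP y 0.
  by rewrite expr0n/= ltNge u0/= ltNge (le_trans y0)// sqrtr_ge0.
by rewrite -[in RHS](ger0_norm (ltW y0)) -sqrtr_sqr ltr_sqrt// exprn_gt0.
Qed.

Let measurable_1Dsqrt : measurable_fun setT (fun u : R => 1 + Num.sqrt u).
Proof.
apply: measurable_funD => //.
by apply: continuous_measurable_fun; exact: sqrt_continuous.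
Qed.

(** Here the power of 1 + sqrt u is integrable only beyond 2, so the midpoint is taken of 2 and
    1/gamma, an interval that is nonempty because gamma < 1/2. *)
Let p_bnd : 0 < (2 + gamma^-1) / 2 < gamma^-1.
Proof. by apply/andP; split; move: alpha2; lra. Qed.

Let int_1Dsqrt : (\int[lebesgue_measure]_(u in `[0%R, +oo[)
  ((1 + Num.sqrt u) `^ (- ((2 + gamma^-1) / 2)))%:E < +oo)%E.
Proof. by rewrite integral_powR_1Dsqrt ?ltry//; move: alpha2; lra. Qed.

Lemma upper_sqr_cvg :
  upper_sqr x / (x ^+ 2 * survival X x) @[x --> +oo] -->
  2 / ((gamma^-1 - 1) * (gamma^-1 - 2)).
Proof.
have <- : \int[lebesgue_measure]_(u in `[0%R, +oo[)
    ((1 + Num.sqrt u) `^ (- gamma^-1)) = 2 / ((gamma^-1 - 1) * (gamma^-1 - 2)).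
  by rewrite /Rintegral integral_powR_1Dsqrt//; move: alpha2; lra.
apply: (@upper_moment_cvg _ _ _ _ X _ gamma0 hU 2
  (fun u => 1 + Num.sqrt u) ((2 + gamma^-1) / 2)) => //.
by move=> u u0; have := sqrtr_ge0 u; lra.
Qed.

Lemma sqr_integrable : ('E_P[fun w => (neg_part (X w) ^+ 2)%R] < +oo)%E ->
  P.-integrable setT (fun w => (X w ^+ 2)%:E).
Proof.
rewrite unlock => hX.
have [x0 x00 /(_ _ (lexx _)) I] := upper_moment_integrable gamma0 hU
  sqrt_excess p_bnd measurable_1Dsqrt
  (fun u u0 => ltac:(have := sqrtr_ge0 u; lra)) int_1Dsqrt.
have J : P.-integrable setT (EFin \o fun w => neg_part (X w) ^+ 2).
  apply/integrableP; split.
    apply/measurable_EFinP; apply: measurable_funX.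
    exact: (measurableT_comp (@measurable_neg_part R)).
  by under eq_integral do rewrite gee0_abs ?lee_fin ?sqr_ge0//.
have K : P.-integrable setT (EFin \o fun _ : T => 2 * x0 ^+ 2).
  exact: finite_measure_integrable_cst.
(* The dominating function is 2(X - x0)_+^2 + X_-^2 + 2 x0^2; above x0 it rests on X^2 <= 2(X -
   x0)^2 + 2 x0^2. *)
have S := integrableD measurableT (integrableD measurableT
  (integrableZl measurableT 2 I) J) K.
apply: le_integrable S => //.
  by apply/measurable_EFinP; exact: measurable_funX.
move=> w _ /=; rewrite lee_fin !ger0_norm ?sqr_ge0//; last first.
  have := sqr_ge0 (pos_part (X w - x0)); have := sqr_ge0 (neg_part (X w)).
  by have := sqr_ge0 x0; lra.
rewrite /pos_part /neg_part.
have [a|a] := leP (X w - x0) 0; have [b|b] := leP (X w) 0.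
- by nra.
- by nra.
- by lra.
- by have := sqr_ge0 (X w - 2 * x0); nra.
Qed.

End RegularlyVarying.

(** * The expectile loss and its first-order condition *)

Section SquareIntegrable.
Hypothesis X2 : P.-integrable setT (fun w => (X w ^+ 2)%:E).

Lemma le_sqr_integrable (f : T -> R) (a b : R) : measurable_fun setT f ->
  (forall w, `|f w| <= a * X w ^+ 2 + b) -> P.-integrable setT (EFin \o f).
Proof.
move=> mf fX.
have S := integrableD measurableT (integrableZl measurableT a X2)
  (finite_measure_integrable_cst P b measurableT).
apply: le_integrable S => //; first exact/measurable_EFinP.
by move=> w _ /=; rewrite lee_fin (le_trans (fX w))// ler_norm.
Qed.

Lemma RV_integrable : P.-integrable setT (EFin \o X).
Proof.
apply: (@le_sqr_integrable _ 1 1) => // w.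
by rewrite ler_norml; apply/andP; split; nra.
Qed.

Lemma measurable_excess x : measurable_fun setT (fun w => pos_part (X w - x)).
Proof.
apply: (measurableT_comp (@measurable_pos_part R)).
exact: measurable_funB.
Qed.

Lemma excess_integrable x :
  P.-integrable setT (EFin \o fun w => pos_part (X w - x)).
Proof.
apply: (@le_sqr_integrable _ 1 (1 + x ^+ 2)); first exact: measurable_excess.
move=> w; rewrite /pos_part ler_norml.
have := sqr_ge0 (X w - 1); have := sqr_ge0 (x + 1).
have := sqr_ge0 (X w); have := sqr_ge0 x.
by case: (leP (X w - x) 0) => ? ? ? ? ?; apply/andP; split; nra.
Qed.

Lemma sqr_excess_integrable x :
  P.-integrable setT (EFin \o fun w => pos_part (X w - x) ^+ 2).
Proof.
apply: (@le_sqr_integrable _ 2 (2 * x ^+ 2)).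
  by apply: measurable_funX; exact: measurable_excess.
move=> w; rewrite ger0_norm ?sqr_ge0// /pos_part.
case: (leP (X w - x) 0) => a; first by nra.
by have := sqr_ge0 (X w + x); nra.
Qed.

Definition mean : R := \int[P]_w X w.
Definition mean_sqr : R := \int[P]_w (X w ^+ 2).

Lemma Rintegral_cstT (c : R) : \int[P]_w c = c.
Proof. by rewrite /Rintegral integral_cst//= probability_setT mule1. Qed.

Lemma integrable_cstT (c : R) : P.-integrable setT (EFin \o fun _ : T => c).
Proof. exact: finite_measure_integrable_cst. Qed.

Lemma integrableZlT (f : T -> R) (c : R) : P.-integrable setT (EFin \o f) ->
  P.-integrable setT (EFin \o fun w => c * f w).
Proof. exact: integrableZl. Qed.

Lemma integrableDT (f g : T -> R) : P.-integrable setT (EFin \o f) ->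
  P.-integrable setT (EFin \o g) ->
  P.-integrable setT (EFin \o fun w => f w + g w).
Proof. exact: integrableD. Qed.

(** Since y_-^2 = y^2 - y_+^2, the loss and the lower half of the deviatile are both combinations of
    these four integrands, so integrability is settled once. *)
Lemma integral_quadratic (c0 c1 c2 c3 x : R) :
  (\int[P]_w (c0 + c1 * X w + c2 * X w ^+ 2 + c3 * pos_part (X w - x) ^+ 2)%:E =
  (c0 + c1 * mean + c2 * mean_sqr + c3 * upper_sqr x)%:E)%E.
Proof.
have I0 := integrable_cstT c0.
have I1 := integrableZlT c1 RV_integrable.
have I2 := integrableZlT c2 X2.
have I3 := integrableZlT c3 (sqr_excess_integrable x).
have I01 := integrableDT I0 I1.
have I012 := integrableDT I01 I2.
rewrite -[LHS]fineK; last exact: integrable_fin_num (integrableDT I012 I3).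
rewrite -/(Rintegral P setT _) !RintegralD// Rintegral_cstT.
rewrite !RintegralZl//; [exact: sqr_excess_integrable|exact: RV_integrable].
Qed.

Lemma neg_part_sqr (y : R) : neg_part y ^+ 2 = y ^+ 2 - pos_part y ^+ 2.
Proof. by rewrite /neg_part /pos_part; case: (leP y 0) => _; ring. Qed.

Lemma lower_sqrE x : ('E_P[fun w => (neg_part (X w - x) ^+ 2)%R] =
  (x ^+ 2 - 2 * x * mean + mean_sqr - upper_sqr x)%:E)%E.
Proof.
have -> : x ^+ 2 - 2 * x * mean + mean_sqr - upper_sqr x =
  x ^+ 2 + (- (2 * x)) * mean + 1 * mean_sqr + (-1) * upper_sqr x by ring.
rewrite unlock -integral_quadratic; apply: eq_integral => w _; congr EFin.
by rewrite neg_part_sqr; ring.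
Qed.

Lemma upper_sqrE x :
  ('E_P[fun w => (pos_part (X w - x) ^+ 2)%R] = (upper_sqr x)%:E)%E.
Proof.
by rewrite unlock fineK// integrable_fin_num//; exact: sqr_excess_integrable.
Qed.

(* Uses tau y_+^2 + (1 - tau) y_-^2 = (1 - tau) y^2 + (2 tau - 1) y_+^2. *)
Definition real_loss (tau x : R) : R :=
  (1 - tau) * (x ^+ 2 - 2 * x * mean + mean_sqr) + (2 * tau - 1) * upper_sqr x.

Lemma expectile_lossE tau x : expectile_loss X tau x = (real_loss tau x)%:E.
Proof.
have -> : real_loss tau x =
  (1 - tau) * x ^+ 2 + (- (2 * (1 - tau) * x)) * mean + (1 - tau) * mean_sqr
    + (2 * tau - 1) * upper_sqr x by rewrite /real_loss; ring.
rewrite /expectile_loss unlock -integral_quadratic.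
apply: eq_integral => w _; congr EFin.
by rewrite neg_part_sqr; ring.
Qed.

(** The supporting-line inequality of the convex map y -> (X - y)_+^2, whose slope at x is -2(X -
    x)_+, is integrated pointwise; this avoids differentiating under the expectation. *)
Lemma upper_sqr_convex x y :
  upper_sqr x - 2 * (y - x) * upper_mean x <= upper_sqr y.
Proof.
have I1 := sqr_excess_integrable x.
have I2 := integrableZlT (- (2 * (y - x))) (excess_integrable x).
have -> : upper_sqr x - 2 * (y - x) * upper_mean x = \int[P]_w
    (pos_part (X w - x) ^+ 2 + (- (2 * (y - x))) * pos_part (X w - x)).
  rewrite RintegralD// RintegralZl//; last exact: excess_integrable.
  by rewrite mulNr.
apply: le_Rintegral => //; first exact: integrableDT.
  exact: sqr_excess_integrable.
move=> w _; have -> : y - x = (X w - x) - (X w - y) by ring.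
rewrite /pos_part; move: (X w - x) (X w - y) => a b.
have := sqr_ge0 (a - b); have := sqr_ge0 b.
by case: (leP a 0) => ?; case: (leP b 0) => ? ? ?; nra.
Qed.

(** Inherited from the 1-Lipschitz positive part; exchanging x and y gives the continuity that the
    intermediate value theorem needs. *)
Lemma upper_mean_lipschitz x y : upper_mean x <= upper_mean y + `|x - y|.
Proof.
rewrite -{1}(Rintegral_cstT `|x - y|).
rewrite -RintegralD//; [|exact: excess_integrable|exact: integrable_cstT].
apply: le_Rintegral => //; first exact: excess_integrable.
  by apply: integrableDT; [exact: excess_integrable|exact: integrable_cstT].
move=> w _; rewrite /pos_part.
have := ler_norm (x - y); have := ler_norm (y - x); rewrite [`|y - x|]distrC.
by case: (leP (X w - x) 0) => ?; case: (leP (X w - y) 0) => ? ? ?; lra.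
Qed.

Lemma upper_mean_continuous : continuous upper_mean.
Proof.
move=> x; apply/cvgrPdist_le => e e0; near=> y.
have xy : `|x - y| <= e.
  by near: y; exact: (@cvgr_dist_le _ _ _ _ _ id x).
have := upper_mean_lipschitz x y; have := upper_mean_lipschitz y x.
by rewrite [`|y - x|]distrC ler_norml; lra.
Unshelve. all: by end_near. Qed.

(* Minus half the derivative of real_loss tau. *)
Definition score (tau x : R) : R :=
  (1 - tau) * (mean - x) + (2 * tau - 1) * upper_mean x.

Lemma expectile_score0 tau x : 2^-1 < tau < 1 -> score tau x = 0 ->
  expectile X tau = x.
Proof.
move=> /andP[tau2 tau1] sx.
(* The linear term in y - x is a multiple of the score and vanishes. The remaining quadratic gap
   makes x the unique minimizer, so the choice in [expectile] can only return x. *)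
have gap y : real_loss tau x + (1 - tau) * (y - x) ^+ 2 <= real_loss tau y.
  have := upper_sqr_convex x y; rewrite -(@ler_pM2l _ (2 * tau - 1)); last lra.
  have : 2 * (y - x) * score tau x = 0 by rewrite sx mulr0.
  by rewrite /score /real_loss; lra.
have xmin y : (expectile_loss X tau x <= expectile_loss X tau y)%E.
  rewrite !expectile_lossE lee_fin (le_trans _ (gap y))// lerDl.
  by rewrite mulr_ge0 ?sqr_ge0//; lra.
have : [set x | forall y,
    (expectile_loss X tau x <= expectile_loss X tau y)%E] (expectile X tau).
  by apply: getPex; exists x.
move=> /(_ x); rewrite !expectile_lossE lee_fin => le_x.
have := gap (expectile X tau) => ge_x.
have : (1 - tau) * (expectile X tau - x) ^+ 2 <= 0 by lra.
rewrite pmulr_rle0; last lra.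
by rewrite le_eqVlt ltNge sqr_ge0 orbF sqrf_eq0 subr_eq0 => /eqP.
Qed.

(** Markov's inequality at level 1 for the excess; it transfers the positivity of the survival
    function to [upper_mean]. *)
Lemma le_survival_upper_mean x : survival X (x + 1) <= upper_mean x.
Proof.
pose A := X @^-1` `]x + 1, +oo[%classic.
have mA : measurable A by exact: measurable_funPTI.
have -> : survival X (x + 1) = \int[P]_w (\1_A w).
  by rewrite /Rintegral integral_indic// setIT.
apply: le_Rintegral => //.
- exact: integrable_indic.
- exact: excess_integrable.
move=> w _; rewrite indicE /pos_part.
have [|_] := boolP (w \in A); last by rewrite le_max lexx orbT.
by rewrite inE /A/= in_itv/= andbT le_max => ?; apply/orP; left; lra.
Qed.

(** * Existence and divergence of the expectile near level 1 *)

Section Expectile.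
Variable gamma : R.
Hypothesis hgamma : 0 < gamma < 2^-1.
Hypothesis hU : regularly_varying gamma (tail_quantile X).

Lemma upper_mean_gt0 x : 0 < upper_mean x.
Proof.
case/andP: hgamma => g0 _.
apply: lt_le_trans (le_survival_upper_mean x).
exact: survival_gt0 g0 hU _.
Qed.

Lemma upper_mean_small : upper_mean x / x @[x --> +oo] --> (0 : R).
Proof.
case/andP: (hgamma) => g0 _.
rewrite -(mulr0 ((gamma^-1 - 1)^-1)).
apply: cvg_trans (cvgM (upper_mean_cvg hgamma hU) (survival_cvg0 X)).
apply: near_eq_cvg; near=> x => /=.
have x0 : 0 < x by [].
have N0 := survival_gt0 g0 hU x.
by field; rewrite !gt_eqF.
Unshelve. all: by end_near. Qed.

(** The score at M tends to the positive number [upper_mean M] as tau tends to 1, and it is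
    nonpositive far to the right. A root in between is the expectile, which yields the lower bound
    and the first-order condition together. *)
Lemma expectile_near1 (M : R) : \forall tau \near 1^'-,
  M <= expectile X tau /\ score tau (expectile X tau) = 0.
Proof.
have sM : score tau M @[tau --> 1^'-] --> upper_mean M.
  have -> : upper_mean M = (1 - 1) * (mean - M) + (2 * 1 - 1) * upper_mean M.
    by ring.
  have id1 : tau @[tau --> (1 : R)^'-] --> (1 : R).
    by apply: cvg_at_left_filter; exact: cvg_id.
  apply: cvgD; apply: cvgMr_tmp.
    by apply: cvgB => //; exact: cvg_cst.
  by apply: cvgB; [exact: cvgMl_tmp|exact: cvg_cst].
near=> tau.
have tau1 : tau < 1 by near: tau; exact: nbhs_left_lt.
have tau2 : 2^-1 < tau by near: tau; apply: nbhs_left_gt; lra.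
have sMtau : 0 < score tau M.
  by near: tau; apply: (cvgr_gt _ sM); exact: upper_mean_gt0.
have [B MB sB] : exists2 B, M <= B & score tau B <= 0.
  (* Half of the term -(1 - tau) B absorbs (1 - tau) EX and the other half absorbs the upper mean,
     hence the two factors 2. *)
  have [B [BM B0 Bm Bu]] : exists B, [/\ M <= B, 0 < B, 2 * mean <= B &
      upper_mean B / B <= (1 - tau) / 2].
    apply: (@filter_ex _ (pinfty_nbhs R)); near=> B; split.
    - by near: B; apply: nbhs_pinfty_ge; exact: num_real.
    - by near: B; apply: nbhs_pinfty_gt; exact: num_real.
    - by near: B; apply: nbhs_pinfty_ge; exact: num_real.
    - by near: B; apply: (cvgr_le _ upper_mean_small); lra.
  exists B => //; rewrite /score; move: Bu; rewrite ler_pdivrMr// => Bu.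
  have := upper_mean_gt0 B => m0.
  have : (2 * tau - 1) * upper_mean B <= upper_mean B.
    by rewrite ler_piMl ?ltW//; lra.
  have : (1 - tau) * (2 * mean) <= (1 - tau) * B by rewrite ler_pM2l//; lra.
  lra.
have cs : {within `[M, B], continuous (score tau)}.
  apply: continuous_subspaceT => x; apply: cvgD; apply: cvgMl_tmp.
    by apply: cvgB; [exact: cvg_cst|exact: cvg_id].
  exact: upper_mean_continuous.
have [|c] := @IVT _ _ _ _ 0 MB cs.
  by rewrite ge_min le_max sB (ltW sMtau) orbT.
rewrite in_itv/= => /andP[Mc _] sc.
by rewrite (expectile_score0 _ sc) ?tau2.
Unshelve. all: by end_near. Qed.

End Expectile.

End SquareIntegrable.
End SecondMoment.

(** * Asymptotics of expectile, quantile and deviatile *)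

Section ExpectileAsymptotics.
Context d (T : measurableType d) (R : realType) (P : probability T R).
Variables (X : {RV P >-> R}) (gamma : R).
Hypothesis hgamma : 0 < gamma < 2^-1.
Hypothesis hU : regularly_varying gamma (tail_quantile X).
Hypothesis hX : ('E_P[fun w => (neg_part (X w) ^+ 2)%R] < +oo)%E.

Let gamma0 : 0 < gamma. Proof. by case/andP: hgamma. Qed.

Let alpha2 : 2 < gamma^-1.
Proof.
by case/andP: hgamma => g0 g2; rewrite -[2]invrK ltf_pV2 ?posrE ?invr_gt0.
Qed.

Local Notation N := (survival X).
Local Notation e := (expectile X).
Let Npos x : 0 < N x. Proof. exact: survival_gt0 gamma0 hU x. Qed.

Let X2 : P.-integrable setT (fun w => (X w ^+ 2)%:E).
Proof. exact: sqr_integrable hgamma hU hX. Qed.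

Let tau_cvg1 : tau @[tau --> (1 : R)^'-] --> (1 : R).
Proof. by apply: cvg_at_left_filter; exact: cvg_id. Qed.

(** A varying factor m is trapped between constants c1 < m0 < c2; U is monotone, and continuity of
    the power at m0 closes the squeeze. *)
Lemma tail_quantile_inv_survival_comp {I : Type} (F : set_system I)
    {FF : ProperFilter F} (x m : I -> R) (m0 : R) : 0 < m0 ->
  x i @[i --> F] --> +oo -> m i @[i --> F] --> m0 ->
  tail_quantile X (m i / N (x i)) / x i @[i --> F] --> m0 `^ gamma.
Proof.
move=> m00 xF mF.
have xp : \forall i \near F, 0 < x i by move/cvgryPgt : xF => /(_ 0).
have NF (c : R) : 0 < c -> \forall i \near F, N (x i) < c.
  by move=> c0; apply: (cvgr_lt _ (cvg_comp _ _ xF (survival_cvg0 X))).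
have UF (c : R) : 0 < c ->
    tail_quantile X (c / N (x i)) / x i @[i --> F] --> c `^ gamma.
  move=> c0; exact: (cvg_comp _ _ xF
    (tail_quantile_inv_survival gamma0 hU c0)).
have pc := @powR_continuous_gt0 _ gamma _ m00.
(* The condition N < c puts the arguments of U beyond 1, where its monotonicity is established. *)
have mono (c c' : R) i : c < c' -> 0 < x i -> N (x i) < c ->
    tail_quantile X (c / N (x i)) / x i <= tail_quantile X (c' / N (x i)) / x i.
  move=> cc' xi Nc; rewrite ler_pM2r ?invr_gt0//.
  apply: tail_quantile_nondecreasing; first by rewrite ltr_pdivlMr ?mul1r.
  by rewrite ler_pM2r ?invr_gt0// ltW.
apply/cvgrPdist_le => eps eps0.
have [c1 [c1m c10 c1e]] : exists c1, [/\ c1 < m0, 0 < c1 &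
    m0 `^ gamma - eps < c1 `^ gamma].
  apply: (@filter_ex _ (m0^'-)); near=> c; split.
  - by near: c; exact: nbhs_left_lt.
  - by near: c; exact: nbhs_left_gt.
  - near: c; apply: (cvgr_gt _ (cvg_at_left_filter pc)).
    by rewrite ltrBlDr ltrDl.
have [c2 [c2m c2e]] : exists c2, [/\ m0 < c2 &
    c2 `^ gamma < m0 `^ gamma + eps].
  apply: (@filter_ex _ (m0^'+)); near=> c; split.
  - by near: c; exact: nbhs_right_gt.
  - near: c; apply: (cvgr_lt _ (cvg_at_right_filter pc)).
    by rewrite ltrDl.
have c20 : 0 < c2 by exact: lt_trans c2m.
near=> i.
have xi : 0 < x i by near: i.
have N1 : N (x i) < c1 by near: i; exact: NF.
have m1 : c1 < m i by near: i; exact: (cvgr_gt _ mF).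
have m2 : m i < c2 by near: i; exact: (cvgr_lt _ mF).
have u1 := mono _ _ _ m1 xi N1.
have u2 := mono _ _ _ m2 xi (lt_trans N1 m1).
have l1 : m0 `^ gamma - eps < tail_quantile X (c1 / N (x i)) / x i.
  by near: i; exact: (cvgr_gt _ (UF _ c10)).
have l2 : tail_quantile X (c2 / N (x i)) / x i < m0 `^ gamma + eps.
  by near: i; exact: (cvgr_lt _ (UF _ c20)).
by rewrite ler_norml; lra.
Unshelve. all: by end_near. Qed.

Lemma expectile_cvgy : e tau @[tau --> 1^'-] --> +oo.
Proof.
apply/cvgryPge => M.
by apply: filterS (expectile_near1 X2 hgamma hU M) => tau [].
Qed.

Lemma expectile_gt (M : R) : \forall tau \near 1^'-, M < e tau.
Proof. by move/cvgryPgt: expectile_cvgy => /(_ M). Qed.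

Let inv_e : (e tau)^-1 @[tau --> 1^'-] --> (0 : R).
Proof.
apply/gtr0_cvgV0; [exact: expectile_gt|exact: expectile_cvgy].
Qed.

Lemma expectile_survival :
  (1 - tau) / N (e tau) @[tau --> 1^'-] --> (gamma^-1 - 1)^-1.
Proof.
have h1 := cvg_comp _ _ expectile_cvgy (upper_mean_cvg hgamma hU).
have h2 : 1 - mean X * (e tau)^-1 @[tau --> 1^'-] --> (1 : R).
  rewrite -[X in _ --> X](subr0 1) -[X in _ - X](mulr0 (mean X)).
  by apply: cvgB; [exact: cvg_cst|exact: cvgMl_tmp].
have h3 : 2 * tau - 1 @[tau --> (1 : R)^'-] --> (1 : R).
  rewrite [X in _ --> X](_ : _ = 2 * 1 - 1); last by ring.
  by apply: cvgB; [exact: cvgMl_tmp|exact: cvg_cst].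
rewrite [X in _ --> X](_ : _ = 1 * ((gamma^-1 - 1)^-1 * 1^-1)); last first.
  by rewrite invr1 mulr1 mul1r.
(* Solved for 1 - tau and divided by N(e), the first-order condition reads (2 tau - 1) times
   E(X-e)_+ / (e N(e)) times 1/(1 - EX/e). *)
apply: cvg_trans (cvgM h3 (cvgM h1 (cvgV (oner_neq0 R) h2))).
apply: near_eq_cvg.
near=> tau => /=.
have e0 : 0 < e tau by near: tau; exact: expectile_gt.
have em : mean X < e tau.
  by near: tau; exact: expectile_gt.
have s0 : score X tau (e tau) = 0.
  near: tau.
  by apply: filterS (expectile_near1 X2 hgamma hU 0) => tau [].
have Ne := Npos (e tau).
have h : (2 * tau - 1) * upper_mean X (e tau)
    = (1 - tau) * (e tau - mean X).
  by move: s0; rewrite /score; lra.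
rewrite mulrA mulrA h.
by field; rewrite !gt_eqF//= subr_gt0.
Unshelve. all: by end_near. Qed.

Let survival_expectile :
  N (e tau) / (1 - tau) @[tau --> 1^'-] --> gamma^-1 - 1.
Proof.
rewrite -[gamma^-1 - 1]invrK; under eq_fun do rewrite -invf_div.
by apply: cvgV expectile_survival; rewrite invr_eq0 gt_eqF//; move: alpha2; lra.
Qed.

(** The factor m = N(e)/(1 - tau) is chosen so that m/N(e) = 1/(1 - tau), the argument at which U
    equals q_tau. *)
Lemma quantile_expectile :
  quantile X tau / e tau @[tau --> 1^'-] --> (gamma^-1 - 1) `^ gamma.
Proof.
have a1 : 0 < gamma^-1 - 1 by move: alpha2; lra.
apply: cvg_trans (tail_quantile_inv_survival_comp a1 expectile_cvgy
  survival_expectile).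
apply: near_eq_cvg; near=> tau.
have tau1 : tau < 1 by near: tau; exact: nbhs_left_lt.
rewrite mulrAC divff ?mul1r ?gt_eqF// /tail_quantile invrK.
by congr (quantile X _ / _); ring.
Unshelve. all: by end_near. Qed.

Lemma deviatile_expectile :
  deviatile X tau / e tau @[tau --> 1^'-] --> Num.sqrt (1 - 2 * gamma)^-1.
Proof.
pose b tau := upper_sqr X (e tau) / (e tau ^+ 2 * N (e tau)).
have h1 : b tau @[tau --> 1^'-] --> 2 / ((gamma^-1 - 1) * (gamma^-1 - 2)).
  exact: cvg_comp _ _ expectile_cvgy (upper_sqr_cvg hgamma hU).
have h2 : N (e tau) @[tau --> 1^'-] --> (0 : R).
  exact: cvg_comp _ _ expectile_cvgy (survival_cvg0 X).
(* [V] is dev_tau^2 / e^2 written in convergent factors: the first term is the upper half, with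
   limit 2/(1/gamma - 2), and the bracket is the expanded lower half, with limit 1. *)
pose V tau := tau * (b tau * (N (e tau) / (1 - tau)))
  + (1 - (2 * mean X) * (e tau)^-1
     + mean_sqr X * ((e tau)^-1 * (e tau)^-1) - b tau * N (e tau)).
have hV : V tau @[tau --> 1^'-] --> (1 - 2 * gamma)^-1.
  have -> : (1 - 2 * gamma)^-1 =
    1 * (2 / ((gamma^-1 - 1) * (gamma^-1 - 2)) * (gamma^-1 - 1))
    + (1 - (2 * mean X) * 0 + mean_sqr X * (0 * 0)
       - 2 / ((gamma^-1 - 1) * (gamma^-1 - 2)) * 0).
    have /andP[g0 g2] := hgamma.
    by field; rewrite !gt_eqF//; lra.
  apply: cvgD.
    by apply: cvgM => //; exact: cvgM.
  apply: cvgB; last exact: cvgM.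
  apply: cvgD; last by apply: cvgMl_tmp; exact: cvgM.
  by apply: cvgB; [exact: cvg_cst|exact: cvgMl_tmp].
apply: cvg_trans (cvg_comp _ _ hV (@sqrt_continuous _ _)).
apply: near_eq_cvg; near=> tau => /=.
have tau1 : tau < 1 by near: tau; exact: nbhs_left_lt.
have e0 : 0 < e tau by near: tau; exact: expectile_gt.
have Ne := Npos (e tau).
rewrite /deviatile /deviatile_sqr (upper_sqrE X2).
rewrite (lower_sqrE X2) /=.
rewrite -[X in _ = _ / X](ger0_norm (ltW e0)) -sqrtr_sqr.
rewrite -sqrtrV ?sqr_ge0// mulrC -sqrtrM ?invr_ge0 ?sqr_ge0//.
congr Num.sqrt; rewrite /V /b.
field; rewrite !gt_eqF//; lra.
Unshelve. all: by end_near. Qed.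

End ExpectileAsymptotics.

Theorem theorem1 (d : measure_display) (T : measurableType d) (R : realType)
    (P : probability T R) (X : {RV P >-> R}) (gamma : R)
    (hX : ('E_P[fun w => (neg_part (X w) ^+ 2)%R] < +oo)%E)
    (hgamma : 0 < gamma < 2^-1)
    (hU : regularly_varying gamma (tail_quantile X)) :
  let beta := (gamma^-1 - 1) `^ (- gamma) / Num.sqrt (1 - 2 * gamma) in
  asymp_equiv 1^'- (deviatile X) (fun tau => beta * quantile X tau).
Proof.
move=> beta; rewrite /asymp_equiv.
have /andP[g0 g2] := hgamma.
have a2 : 2 < gamma^-1 by rewrite -[2]invrK ltf_pV2 ?posrE ?invr_gt0.
have ag : 0 < (gamma^-1 - 1) `^ gamma by apply: powR_gt0; lra.
have sg : 0 < Num.sqrt (1 - 2 * gamma) by rewrite sqrtr_gt0; lra.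
have b0 : 0 < beta by rewrite /beta divr_gt0// powR_gt0//; lra.
have hd := deviatile_expectile hgamma hU hX.
have hq := quantile_expectile hgamma hU hX.
(* The limit 1 is written as the quotient of the limits of dev_tau / e and beta q_tau / e, in which
   e cancels. *)
rewrite [X in _ --> X](_ : _ = Num.sqrt (1 - 2 * gamma)^-1
    / (beta * (gamma^-1 - 1) `^ gamma)); last first.
  rewrite /beta powRN sqrtrV; last lra.
  by field; rewrite !gt_eqF.
have bq : beta * (gamma^-1 - 1) `^ gamma != 0 by rewrite gt_eqF// mulr_gt0.
apply: cvg_trans (cvgM hd (cvgV bq (@cvgMl_tmp _ _ _ _ _ beta _ hq))).
apply: near_eq_cvg; near=> tau => /=.
have e0 : 0 < expectile X tau.
  by near: tau; exact: (expectile_gt hgamma hU hX).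
have q0 : 0 < quantile X tau / expectile X tau.
  by near: tau; apply: (cvgr_gt _ hq).
rewrite mulrA invf_div mulrA divfK ?gt_eqF//.
Unshelve. all: by end_near. Qed.
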